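(* For all integers $r\ge 2$ and $d\ge 1$, with $N=(r-1)(d+1)$, there exists an $\mathfrak{S}_r$-equivariant continuous map $$F:(\Delta_{r,r})^{*(d+1)}\longrightarrow W_r^{\oplus(d+1)}\setminus\{0\}\ \simeq\ S^{N-1}.$$
   Context: $\mathfrak{S}_r$ is the symmetric group on $r$ letters. The chessboard complex $\Delta_{m,n}$ is the simplicial complex with vertex set $\{1,\dots,m\}\times\{1,\dots,n\}$ ($m$ rows, $n$ columns) whose simplices are the sets of vertices no two of which lie in the same row or in the same column. $\mathfrak{S}_r$ acts on $\Delta_{r,n}$ by permuting the $r$ rows, and diagonally on joins of such complexes; $K^{*(d+1)}$ denotes the $(d+1)$-fold join of $K$ with itself. $W_r=\{(\xi_1,\dots,\xi_r)\in\mathbb{R}^r:\xi_1+\dots+\xi_r=0\}$ is the $(r-1)$-dimensional real representation of $\mathfrak{S}_r$ given by permuting coordinates; $W_r^{\oplus(d+1)}$ is identified with the space of real $r\times(d+1)$ matrices with all column sums zero, on which $\mathfrak{S}_r$ acts by permuting rows. *)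

(* Defs.v *)
From HB Require Import structures.
From mathcomp Require Import all_boot all_order all_algebra all_fingroup.
From mathcomp Require Import all_classical all_reals all_analysis.

Set Implicit Arguments.
Unset Strict Implicit.
Unset Printing Implicit Defensive.

Import GroupScope.
Import Order.TTheory GRing.Theory Num.Theory numFieldNormedType.Exports.
Local Open Scope classical_set_scope.
Local Open Scope ring_scope.

(* Finite abstract simplicial complexes on the vertex set V.  The empty set
   is a face, so that faces of a join may miss some of the factors. *)
Record complex (V : finType) := Complex {
  faces :> {set {set V}};
  faces0 : finset.set0 \in faces;
  faces1 : forall v, [set v]%SET \in faces;
  facesS : forall S T : {set V}, S \subset T -> T \in faces -> S \in faces }.

Section Chessboard.
Variables m n : nat.

Definition chessboard_faces : {set {set 'I_m * 'I_n}} :=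
  [set S : {set 'I_m * 'I_n} |
    [forall u in S, forall v in S, (u != v) ==> (u.1 != v.1) && (u.2 != v.2)]]%SET.

Lemma chessboard_facesP (S : {set 'I_m * 'I_n}) :
  reflect {in S &, forall u v, u != v -> u.1 != v.1 /\ u.2 != v.2}
          (S \in chessboard_faces).
Proof.
rewrite finset.in_set; apply: (iffP forall_inP) => [H u v uS vS uv|H u uS].
  by move/forall_inP: (H u uS) => /(_ v vS)/implyP/(_ uv)/andP.
by apply/forall_inP => v vS; apply/implyP => uv; apply/andP/H.
Qed.

Lemma chessboard_faces0 : finset.set0 \in chessboard_faces.
Proof. by apply/chessboard_facesP => u v; rewrite finset.in_set0. Qed.

Lemma chessboard_faces1 v : [set v]%SET \in chessboard_faces.
Proof.
apply/chessboard_facesP => u w; rewrite !finset.in_set1 => /eqP-> /eqP->.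
by rewrite eqxx.
Qed.

Lemma chessboard_facesS (S T : {set 'I_m * 'I_n}) : S \subset T ->
  T \in chessboard_faces -> S \in chessboard_faces.
Proof.
move=> /fintype.subsetP ST /chessboard_facesP H; apply/chessboard_facesP => u v uS vS.
by apply: H; exact: ST.
Qed.

Definition chessboard : complex ('I_m * 'I_n)%type :=
  Complex chessboard_faces0 chessboard_faces1 chessboard_facesS.

End Chessboard.

Section Join.
Variables (V : finType) (K : complex V) (k : nat).

(* The part of S lying in the i-th copy of V. *)
Definition slice (S : {set V * 'I_k}) (i : 'I_k) : {set V} :=
  [set v | (v, i) \in S]%SET.

Definition join_faces : {set {set V * 'I_k}} :=
  [set S : {set V * 'I_k} | [forall i, slice S i \in K]]%SET.

Lemma join_faces0 : finset.set0 \in join_faces.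
Proof.
rewrite finset.in_set; apply/forallP => i; apply: facesS (faces0 K).
by apply/fintype.subsetP => v; rewrite !finset.in_set.
Qed.

Lemma join_faces1 v : [set v]%SET \in join_faces.
Proof.
rewrite finset.in_set; apply/forallP => i; apply: facesS (faces1 K v.1).
by apply/fintype.subsetP => u; rewrite finset.in_set !finset.in_set1 => /eqP <-.
Qed.

Lemma join_facesS (S T : {set V * 'I_k}) : S \subset T ->
  T \in join_faces -> S \in join_faces.
Proof.
move=> /fintype.subsetP ST; rewrite !finset.in_set => /forallP H; apply/forallP => i.
apply: facesS (H i); apply/fintype.subsetP => v; rewrite !finset.in_set; exact: ST.
Qed.

(* The k-fold join of K with itself, on k disjoint copies of V. *)
Definition join_power : complex (V * 'I_k)%type :=
  Complex join_faces0 join_faces1 join_facesS.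

End Join.

Section Realization.
Variables (R : realType) (V : finType) (K : complex V).

(* Barycentric coordinates; as V is finite, the topology of |K| is the one
   induced by the product topology of R^V. *)
Definition realization : set {ptws V -> R} :=
  [set x : V -> R | [/\ forall v, 0 <= x v, \sum_v x v = 1
                      & [set v | x v != 0]%SET \in K]].

End Realization.

Arguments realization R {V} K.

(* Actions of MathComp are right actions.  Since permutations are composed by
   (s * t) i = t (s i), letting s send i to s i is such an action. *)
Record simplicial_action (gT : finGroupType) (V : finType) (K : complex V) :=
  SimplicialAction {
    sact :> {action gT &-> V};
    sact_faces : forall a (S : {set V}),
      S \in K -> [set sact v a | v in S]%SET \in K }.

Section RowAction.
Variables m n : nat.

Definition row_act_fun (v : 'I_m * 'I_n) (s : 'S_m) : 'I_m * 'I_n :=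
  (s v.1, v.2).

Lemma row_act1 v : row_act_fun v 1%g = v.
Proof. by case: v => i j; rewrite /row_act_fun perm1. Qed.

Lemma row_actM v : act_morph row_act_fun v.
Proof. by move=> s t; rewrite /row_act_fun permM. Qed.

Definition row_act : {action 'S_m &-> 'I_m * 'I_n} :=
  TotalAction row_act1 row_actM.

Lemma row_act_faces s (S : {set 'I_m * 'I_n}) : S \in chessboard m n ->
  [set row_act v s | v in S]%SET \in chessboard m n.
Proof.
move=> /chessboard_facesP H; apply/chessboard_facesP.
move=> _ _ /imsetP[u uS ->] /imsetP[v vS ->] uv /=.
have [|H1 H2] := H u v uS vS; first by apply: contraNN uv => /eqP ->.
by rewrite (inj_eq perm_inj).
Qed.

Definition row_action : simplicial_action 'S_m (chessboard m n) :=
  SimplicialAction row_act_faces.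

End RowAction.

Section JoinAction.
Variables (gT : finGroupType) (V : finType) (K : complex V).
Variables (rho : simplicial_action gT K) (k : nat).

Definition diag_act_fun (v : V * 'I_k) (a : gT) : V * 'I_k :=
  (rho v.1 a, v.2).

Lemma diag_act1 v : diag_act_fun v 1%g = v.
Proof. by case: v => v i; rewrite /diag_act_fun act1. Qed.

Lemma diag_actM v : act_morph diag_act_fun v.
Proof. by move=> a b; rewrite /diag_act_fun actM. Qed.

Definition diag_act : {action gT &-> V * 'I_k} :=
  TotalAction diag_act1 diag_actM.

Lemma diag_act_faces a (S : {set V * 'I_k}) : S \in join_power K k ->
  [set diag_act v a | v in S]%SET \in join_power K k.
Proof.
rewrite !finset.in_set => /forallP H; apply/forallP => i.
apply: facesS (sact_faces rho a (H i)); apply/fintype.subsetP => v.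
rewrite finset.in_set => /imsetP[[w j] wS [-> ->]].
by apply: finset.imset_f; rewrite finset.in_set.
Qed.

Definition diag_action : simplicial_action gT (join_power K k) :=
  SimplicialAction diag_act_faces.

End JoinAction.

Section RealizationAction.
Variables (R : realType) (gT : finGroupType) (V : finType) (K : complex V).
Variable rho : simplicial_action gT K.

(* The affine extension to |K| of v |-> rho v a: the point \sum_v x_v v is
   sent to \sum_v x_v (rho v a), whose coordinate at w is x_(rho w a^-1). *)
Definition geom_act_coord (x : {ptws V -> R}) (a : gT) : {ptws V -> R} :=
  fun w => x (rho w a^-1%g).

Lemma geom_act_coordP (x : realization R K) a :
  geom_act_coord (val x) a \in realization R K.
Proof.
have /set_mem[x0 x1 xK] := valP x; apply/mem_set; split.
- by move=> v; exact: x0.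
- rewrite -[RHS]x1 [RHS](reindex_inj (act_inj rho a^-1%g)) /=.
  by apply: eq_bigr.
- apply: facesS (sact_faces rho a xK); apply/fintype.subsetP => w.
  rewrite finset.in_set /geom_act_coord => xw; apply/imsetP.
  by exists (rho w a^-1%g); rewrite ?finset.in_set// actKV.
Qed.

Definition geom_act_fun (x : realization R K) (a : gT) : realization R K :=
  Sub (geom_act_coord (val x) a) (geom_act_coordP x a).

Lemma geom_act1 x : geom_act_fun x 1%g = x.
Proof.
apply: val_inj; rewrite /= /geom_act_coord; apply/funext => w.
by rewrite invg1 act1.
Qed.

Lemma geom_actM x : act_morph geom_act_fun x.
Proof.
move=> a b; apply: val_inj; rewrite /= /geom_act_coord; apply/funext => w /=.
by rewrite invMg actM.
Qed.

Definition geom_action : {action gT &-> realization R K} :=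
  TotalAction geom_act1 geom_actM.

End RealizationAction.

Arguments geom_action R {gT V K} rho.

Section Representation.
Variables (R : realType) (r k : nat).

Definition W_rep : set 'cV[R]_r := [set xi | \sum_(i < r) xi i 0 = 0].

(* The direct sum of k copies of W_rep, as r x k matrices. *)
Definition W_rep_sum : set 'M[R]_(r, k) := [set A | forall j, W_rep (col j A)].

Definition W_rep_sum_minus0 : set 'M[R]_(r, k) := W_rep_sum `\ 0.

Lemma W_act_subproof (A : W_rep_sum_minus0) (s : 'S_r) :
  row_perm s^-1%g (val A) \in W_rep_sum_minus0.
Proof.
have /set_mem[WA A0] := valP A; apply/mem_set; split.
- move=> j; rewrite /W_rep /= -[RHS](WA j).
  rewrite [RHS](reindex_inj (@perm_inj _ s^-1%g)) /=.
  by apply: eq_bigr => i _; rewrite !mxE.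
- rewrite /set1 /= => sA0; apply: A0; rewrite /set1 /=.
  rewrite -[LHS]row_perm1 -(mulgV s) row_permM sA0.
  by apply/matrixP => i j; rewrite !mxE.
Qed.

(* Row i of A is moved to row s i. *)
Definition W_act_fun (A : W_rep_sum_minus0) (s : 'S_r) : W_rep_sum_minus0 :=
  Sub (row_perm s^-1%g (val A)) (W_act_subproof A s).

Lemma W_act1 A : W_act_fun A 1%g = A.
Proof. by apply: val_inj; rewrite /= invg1 row_perm1. Qed.

Lemma W_actM A : act_morph W_act_fun A.
Proof. by move=> s t; apply: val_inj; rewrite /= invMg row_permM. Qed.

Definition W_action : {action 'S_r &-> W_rep_sum_minus0} :=
  TotalAction W_act1 W_actM.

End Representation.

Arguments W_rep_sum_minus0 R r k : clear implicits.
Arguments W_action R r k : clear implicits.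

(* The unit sphere of the Euclidean space R^N (the norm of the library on
   matrices is the sup norm). *)
Definition unit_sphere (R : realType) (N : nat) : set 'rV[R]_N :=
  [set x | \sum_(i < N) x 0 i ^+ 2 = 1].

Arguments unit_sphere R N : clear implicits.

Definition homotopic (R : realType) (X Y : topologicalType) (f g : X -> Y) :=
  exists H : X * R -> Y,
    [/\ {within [set: X] `*` `[0, 1]%classic, continuous H},
        forall x, H (x, 0) = f x & forall x, H (x, 1) = g x].

Definition homotopy_equivalent (R : realType) (X Y : topologicalType) :=
  exists (f : X -> Y) (g : Y -> X),
    [/\ continuous f, continuous g,
        homotopic R (g \o f) id & homotopic R (f \o g) id].

(* Main.v *)
(* Every ridge of the chessboard complex D(r,r) lies in exactly one maximal
   simplex, so D(r,r) can be collapsed equivariantly, which makes an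
   equivariant map D(r,r) -> W_r \ {0} possible although dim D(r,r) = r - 1.
   Explicitly, write a point of the cone over D(r,r) as a nonnegative matrix X
   with at most one nonzero entry in each row and column.  Let s_i be the sum of
   row i, p_i the same sum without the entry in a fixed column c0, and m the
   least of the sums of the columns c <> c0.  Then u_i = s_i - 2 min(m, p_i)
   depends on i unless X = 0: if m = 0 some row of X is zero and u = s; if m > 0
   then u is -m < 0 in the row realizing m, and nonnegative in the row whose
   only possible rook is in column c0.  Centering u and applying this to each
   factor of the join gives F.  The homotopy equivalence is radial projection,
   with the first row of a zero-column-sum matrix dropped to get coordinates. *)
Require Import Defs.
From HB Require Import structures.
From mathcomp Require Import all_boot all_order all_algebra all_fingroup.
From mathcomp Require Import all_classical all_reals all_analysis.

Import numFieldNormedType.Exports.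
Local Open Scope classical_set_scope.
Local Open Scope ring_scope.

Import Order.TTheory GRing.Theory Num.Theory.

(** * Continuity of matrix-valued maps, finite sums and finite minima *)

Lemma continuous_mx (R : realType) (T : topologicalType) (m n : nat)
    (f : T -> 'M[R]_(m, n)) :
  (forall i j, continuous (fun x => f x i j)) -> continuous f.
Proof.
move=> fc x A [P fxP PA]; rewrite nbhs_simpl /=.
(* A neighbourhood of a matrix contains a product of neighbourhoods of its entries; being finitely
   many, these conditions hold together near [x]. *)
have H : \forall y \near x, forall ij : 'I_m * 'I_n, P ij.1 ij.2 (f y ij.1 ij.2).
  apply: filter_forall => -[i j]; exact: (fc i j x _ (fxP i j)).
by apply: filterS H => y Hy; apply: PA => i j; exact: (Hy (i, j)).
Qed.

Lemma continuous_sum (R : realType) (T : topologicalType) (I : Type)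
    (s : seq I) (P : pred I) (f : I -> T -> R) :
  (forall i, continuous (f i)) ->
  continuous (fun x => \sum_(i <- s | P i) f i x).
Proof. by move=> fc; apply: continuous_big => // -[a b]; exact: add_continuous. Qed.

Lemma continuous_mul (R : realType) (T : topologicalType) (f g : T -> R) :
  continuous f -> continuous g -> continuous (fun x => f x * g x).
Proof. by move=> fc gc x; apply: cvgM; [exact: fc | exact: gc]. Qed.

(** The default value varies with the point too, as [colmin] requires; hence the induction on the
    list. *)
Lemma continuous_bigmin (R : realType) (T : topologicalType) (I : Type)
    (s : seq I) (P : pred I) (f0 : T -> R) (f : I -> T -> R) :
  continuous f0 -> (forall i, continuous (f i)) ->
  continuous (fun x => \big[Num.min/(f0 x)]_(i <- s | P i) f i x).
Proof.
move=> f0c fc; elim: s => [|i s IH]; first by under eq_fun do rewrite big_nil.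
under eq_fun do rewrite big_cons.
by case: (P i) => // x; apply: continuous_min; [exact: fc | exact: IH].
Qed.

(** * The vector u of a square matrix and its centering *)

Section BoardMap.
Variables (R : realType) (n : nat).
Implicit Type X : 'M[R]_n.+2.

(** The default value, the sum of column [ord_max], is itself one of the competing sums since
    [ord_max] differs from [ord0]; so this is the true minimum m. *)
Definition colmin X : R :=
  \big[Num.min/(\sum_i X i ord_max)]_(c | c != ord0) \sum_i X i c.

(** The u_i of the overview, with c0 = [ord0]. *)
Definition rowval X (i : 'I_n.+2) : R :=
  \sum_c X i c - 2 * Num.min (colmin X) (\sum_(c | c != ord0) X i c).

Lemma rowval_row_perm (s : 'S_n.+2) X i :
  rowval (row_perm s X) i = rowval X (s i).
Proof.
have colE c : \sum_i row_perm s X i c = \sum_i X i c.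
  rewrite [RHS](reindex_inj (@perm_inj _ s)).
  by apply: eq_bigr => ? _; rewrite mxE.
have cmE : colmin (row_perm s X) = colmin X.
  by rewrite /colmin colE; apply: eq_bigr => c _; rewrite colE.
rewrite /rowval cmE; congr (_ - _ * Num.min _ _);
  by apply: eq_bigr => c _; rewrite mxE.
Qed.

Lemma continuous_rowval (T : topologicalType) (f : T -> 'M[R]_n.+2) i :
  (forall a b, continuous (fun x => f x a b)) ->
  continuous (fun x => rowval (f x) i).
Proof.
move=> fc x; apply: cvgB.
  exact: (@continuous_sum R T _ _ _ (fun c x => f x i c)).
apply: cvgM; first exact: cvg_cst.
apply: (@continuous_min R T (fun x => colmin (f x))).
  apply: continuous_bigmin => [|c].
    exact: (@continuous_sum R T _ _ _ (fun a x => f x a ord_max)).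
  exact: (@continuous_sum R T _ _ _ (fun a x => f x a c)).
exact: (@continuous_sum R T _ _ _ (fun c x => f x i c)).
Qed.

(** The orthogonal projection of u to W_r, zero exactly when u is constant. *)
Definition centered_rowval X i : R :=
  rowval X i - n.+2%:R^-1 * \sum_i' rowval X i'.

Lemma sum_centered_rowval X : \sum_i centered_rowval X i = 0.
Proof.
rewrite sumrB sumr_const card_ord -mulrnAl -mulr_natr mulVf ?pnatr_eq0//.
by rewrite mul1r subrr.
Qed.

Lemma centered_rowval_row_perm (s : 'S_n.+2) X i :
  centered_rowval (row_perm s X) i = centered_rowval X (s i).
Proof.
rewrite /centered_rowval rowval_row_perm; congr (_ - _ * _).
rewrite [RHS](reindex_inj (@perm_inj _ s)).
by apply: eq_bigr => a _; rewrite rowval_row_perm.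
Qed.

Lemma continuous_centered_rowval (T : topologicalType) (f : T -> 'M[R]_n.+2) i :
  (forall a b, continuous (fun x => f x a b)) ->
  continuous (fun x => centered_rowval (f x) i).
Proof.
move=> fc x; apply: cvgB; first exact: continuous_rowval.
apply: cvgM; first exact: cvg_cst.
apply: (@continuous_sum R T _ _ _ (fun i x => rowval (f x) i)) => i'.
exact: continuous_rowval.
Qed.

(** * Nonvanishing on the cone over the chessboard complex; rooks are the nonzero entries *)

Variable X : 'M[R]_n.+2.
Hypothesis X0 : forall i c, 0 <= X i c.
Hypothesis XK : [set v | X v.1 v.2 != 0]%SET \in chessboard n.+2 n.+2.

Let rook_row {i c c'} : X i c != 0 -> X i c' != 0 -> c = c'.
Proof.
move=> ic ic'; apply/eqP; apply: contraTT isT => cc'.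
have /chessboard_facesP/(_ (i, c) (i, c')) := XK.
rewrite !finset.in_set /= xpair_eqE negb_and cc' orbT => /(_ ic ic' isT)[].
by rewrite eqxx.
Qed.

Let rook_col {i i' c} : X i c != 0 -> X i' c != 0 -> i = i'.
Proof.
move=> ic ic'; apply/eqP; apply: contraTT isT => cc'.
have /chessboard_facesP/(_ (i, c) (i', c)) := XK.
rewrite !finset.in_set /= xpair_eqE negb_and cc' => /(_ ic ic' isT)[].
by rewrite eqxx.
Qed.

(* Otherwise the n + 2 rows would have rooks in distinct columns, all different
   from c. *)
Lemma row_free_off_col c : exists i, forall c', c' != c -> X i c' = 0.
Proof.
apply/not_existsP => H.
have /choice[k kP] : forall i, exists c', c' != c /\ X i c' != 0.
  move=> i; apply/not_existsP => Hi; apply: (H i) => c' c'c; apply/eqP.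
  by apply: contrapT => /negP Xic'; apply: (Hi c').
have k_inj : injective k.
  move=> i i' kk; apply: (@rook_col i i' (k i)); first by case: (kP i).
  by rewrite kk; case: (kP i').
have /codomP[i ci] := injF_onto k_inj c.
by case: (kP i); rewrite -ci eqxx.
Qed.

Lemma rowval_const_eq0 : (forall i i', rowval X i = rowval X i') -> X = 0.
Proof.
move=> Xc; have y0 c : 0 <= \sum_i X i c by apply: sumr_ge0.
have p0 i : 0 <= \sum_(c | c != ord0) X i c by apply: sumr_ge0.
have m0 : 0 <= colmin X by apply: le_bigmin.
have mle c : c != ord0 -> colmin X <= \sum_i X i c.
  by move=> c0; exact: bigmin_le_cond.
have [c1 c10 c1m] : exists2 c, c != ord0 & \sum_i X i c <= colmin X.
  have /bigmin_leP[|//] := lexx (colmin X).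
  (* When the default value is the one attaining the minimum, the column is [ord_max]. *)
  by exists ord_max.
have [|m_gt0] := leP (colmin X) 0; last first.
  (* Case m > 0: column [c1] has a rook, alone in its row and column. As [c1] is not [ord0], both s
     and p equal m in that row, so u = -m there. *)
  have [i1 i1c1] : exists i1, X i1 c1 != 0.
    apply/not_existsP => H; have := lt_le_trans m_gt0 (mle _ c10).
    rewrite big1 ?ltxx// => i _; apply/eqP; apply: contrapT => /negP.
    exact: H.
  have i1E c : c != c1 -> X i1 c = 0.
    by move=> cc1; apply/eqP; apply: contraNT cc1 => /(rook_row i1c1) ->.
  have yE : \sum_i X i c1 = X i1 c1.
    rewrite (bigD1 i1)//= big1 ?addr0// => i ii1; apply/eqP.
    by apply: contraNT ii1 => /(rook_col i1c1) ->.
  have sE : \sum_c X i1 c = X i1 c1.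
    by rewrite (bigD1 c1)//= big1 ?addr0// => c /i1E.
  have pE : \sum_(c | c != ord0) X i1 c = X i1 c1.
    by rewrite (bigD1 c1)//= big1 ?addr0// => c /andP[_ /i1E].
  have mE : colmin X = X i1 c1.
    by apply/le_anti; rewrite -yE c1m mle.
  (* In this row p = 0, so u = s >= 0, which contradicts the common value -m. *)
  have [i0 i0E] := row_free_off_col ord0.
  have : 0 <= rowval X i0.
    rewrite /rowval [X in Num.min _ X]big1//.
    by rewrite min_r// mulr0 subr0 sumr_ge0.
  rewrite (Xc i0 i1) /rowval sE pE mE minxx mulr_natl mulr2n opprD addrA subrr.
  by rewrite sub0r oppr_ge0 -mE leNgt m_gt0.
move=> m_le0; have mE : colmin X = 0 by apply/le_anti; rewrite m_le0 m0.
have rE i : rowval X i = \sum_c X i c.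
  by rewrite /rowval mE min_l// mulr0 subr0.
(* Case m = 0: column [c1] is empty, so a row without rooks off [c1] is zero; constancy of u = s
   then makes every row sum vanish. *)
have [i0 i0E] := row_free_off_col c1.
have c1E i : X i c1 = 0.
  have /psumr_eq0P : \sum_i X i c1 = 0.
    by apply/le_anti; rewrite y0 andbT (le_trans c1m)// mE.
  by apply.
have r0 : rowval X i0 = 0.
  rewrite rE big1// => c _; have [->|] := eqVneq c c1; first exact: c1E.
  exact: i0E.
apply/matrixP => i c; rewrite mxE.
have /psumr_eq0P : \sum_c X i c = 0 by rewrite -rE (Xc i i0).
by apply.
Qed.

End BoardMap.

(** * The equivariant map on the join *)

Section EquivariantMap.
Variables (R : realType) (n d : nat).

Let C := join_power (chessboard n.+2 n.+2) d.+1.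

(** Not normalized: the entries sum to the join weight of factor [j], so the block is a point of the
    cone, and is 0 when [x] misses that factor. *)
Definition block (x : realization R C) (j : 'I_d.+1) : 'M[R]_n.+2 :=
  \matrix_(i, c) val x ((i, c), j).

Definition join_map_mx (x : realization R C) : 'M[R]_(n.+2, d.+1) :=
  \matrix_(i, j) centered_rowval R n (block x j) i.

(** A zero image makes u constant on every block, hence all blocks zero, although the coordinates of
    [x] sum to 1. *)
Lemma join_map_mx_in x : join_map_mx x \in W_rep_sum_minus0 R n.+2 d.+1.
Proof.
apply/mem_set; split.
  move=> j; rewrite /W_rep /=; under eq_bigr do rewrite !mxE.
  exact: sum_centered_rowval.
move=> /= F0; have /set_mem[x0 x1 xC] := valP x.
have b0 j : block x j = 0.
  apply: rowval_const_eq0 => [i c||i i'].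
  - by rewrite mxE.
  - move: xC; rewrite finset.in_set => /forallP/(_ j).
    rewrite (_ : slice _ j = [set v | block x j v.1 v.2 != 0]%SET)//.
    by apply/setP => -[i c]; rewrite !finset.in_set mxE.
  - have rE a : rowval R n (block x j) a =
        n.+2%:R^-1 * \sum_i' rowval R n (block x j) i'.
      apply/eqP; rewrite -subr_eq0; have /matrixP/(_ a j) := F0.
      by rewrite !mxE /centered_rowval => ->.
    by rewrite !rE.
move: x1; rewrite big1 => [/eqP|[[i c] j] _]; first by rewrite eq_sym oner_eq0.
by have /matrixP/(_ i c) := b0 j; rewrite !mxE.
Qed.

Definition join_map x : W_rep_sum_minus0 R n.+2 d.+1 :=
  Sub (join_map_mx x) (join_map_mx_in x).

Lemma continuous_join_map : continuous join_map.
Proof.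
have bc j a b : continuous (fun x => block x j a b).
  rewrite (_ : (fun x => _) = (fun x => val x ((a, b), j))); last first.
    by apply/funext => x; rewrite mxE.
  move=> x; apply: (@continuous_comp (realization R C) _ R val
    (fun y : {ptws _ -> R} => y ((a, b), j))); first exact: initial_continuous.
  exact: proj_continuous.
apply: continuous_comp_initial; apply: continuous_mx => i j.
rewrite (_ : (fun x => _) = (fun x => centered_rowval R n (block x j) i)).
  by apply: continuous_centered_rowval; exact: bc.
by apply/funext => x; rewrite mxE.
Qed.

Lemma join_map_equivariant :
  morph_act (geom_action R (diag_action (row_action n.+2 n.+2) d.+1))
            (W_action R n.+2 d.+1) join_map id.
Proof.
move=> x s; apply: val_inj; apply/matrixP => i j; rewrite /= !mxE.
set y := geom_act_fun _ _ _.
have bE : block y j = row_perm s^-1%g (block x j).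
  by apply/matrixP => a c; rewrite !mxE.
by rewrite bE centered_rowval_row_perm.
Qed.

End EquivariantMap.

(** * Homotopy equivalence of the target with a sphere *)

Section SphereEquivalence.
Variables (R : realType) (n k : nat).

Definition enorm (v : 'rV[R]_(n * k)) : R := Num.sqrt (\sum_i v 0 i ^+ 2).

Lemma enorm_gt0 v : v != 0 -> 0 < enorm v.
Proof.
move=> v0; rewrite sqrtr_gt0 lt_def sumr_ge0 ?andbT => [|i _]; last exact: sqr_ge0.
apply: contra v0 => /eqP/psumr_eq0P v0; apply/eqP/rowP => i; rewrite mxE.
by apply/eqP; rewrite -sqrf_eq0 v0// => j _; exact: sqr_ge0.
Qed.

Lemma continuous_enorm (T : topologicalType) (f : T -> 'rV[R]_(n * k)) :
  (forall i, continuous (fun x => f x 0 i)) -> continuous (fun x => enorm (f x)).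
Proof.
move=> fc x; apply: (@continuous_comp _ _ _ (fun x => \sum_i f x 0 i ^+ 2)).
  apply: (@continuous_sum R T _ _ _ (fun i x => f x 0 i ^+ 2)) => i y.
  by under eq_fun do rewrite expr2; apply: cvgM; exact: fc.
exact: sqrt_continuous.
Qed.

(** With zero column sums the first row is minus the sum of the others, so no information is
    lost. *)
Definition row_coords (A : 'M[R]_(n.+1, k)) : 'rV[R]_(n * k) :=
  mxvec (row' ord0 A).

(* The inverse of row_coords on matrices with zero column sums. *)
Definition zero_sum_mx (v : 'rV[R]_(n * k)) : 'M[R]_(n.+1, k) :=
  \matrix_(i, j) if unlift ord0 i is Some i' then vec_mx v i' j
                 else - \sum_i' vec_mx v i' j.

Lemma zero_sum_mx_in v : @W_rep_sum R n.+1 k (zero_sum_mx v).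
Proof.
move=> j; rewrite /W_rep /= big_ord_recl mxE mxE unlift_none.
rewrite [X in _ + X](eq_bigr (fun i => vec_mx v i j)) ?addNr// => i _.
by rewrite mxE mxE liftK.
Qed.

Lemma zero_sum_mxK v : row_coords (zero_sum_mx v) = v.
Proof.
rewrite /row_coords -[RHS]vec_mxK; congr mxvec.
by apply/matrixP => i j; rewrite !mxE liftK mxE.
Qed.

Lemma zero_sum_mxZ a v : zero_sum_mx (a *: v) = a *: zero_sum_mx v.
Proof.
apply/matrixP => i j; rewrite !mxE linearZ /=.
case: unliftP => [i' _|_]; first by rewrite mxE.
by under eq_bigr do rewrite mxE; rewrite -mulr_sumr mulrN.
Qed.

Lemma row_coordsK A : @W_rep_sum R n.+1 k A -> zero_sum_mx (row_coords A) = A.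
Proof.
move=> WA; apply/matrixP => i j; rewrite mxE /row_coords mxvecK.
case: unliftP => [i' ->|->]; first by rewrite mxE.
have := WA j; rewrite /W_rep /= big_ord_recl mxE => /eqP.
rewrite addr_eq0 => /eqP ->; congr (- _).
by apply: eq_bigr => i' _; rewrite !mxE.
Qed.

Lemma row_coords_neq0 (A : W_rep_sum_minus0 R n.+1 k) : row_coords (val A) != 0.
Proof.
have /set_mem[WA A0] := valP A; apply/eqP => rA0; apply: A0 => /=.
(* That [zero_sum_mx] sends 0 to 0 is read off its homogeneity, writing 0 as [0 *: 0]. *)
by rewrite -(row_coordsK _ WA) rA0 -(scale0r 0) zero_sum_mxZ scale0r.
Qed.

Let nA (A : W_rep_sum_minus0 R n.+1 k) := enorm (row_coords (val A)).

Let nA_gt0 A : 0 < nA A.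
Proof. exact/enorm_gt0/row_coords_neq0. Qed.

Lemma scale_in a (A : W_rep_sum_minus0 R n.+1 k) :
  0 < a -> a *: val A \in W_rep_sum_minus0 R n.+1 k.
Proof.
move=> a0; have /set_mem[WA A0] := valP A; apply/mem_set; split.
  move=> j; rewrite /W_rep /=; under eq_bigr do rewrite !mxE.
  rewrite -mulr_sumr; have := WA j; rewrite /W_rep /=.
  by under eq_bigr do rewrite mxE; move=> ->; rewrite mulr0.
move=> /= /eqP; rewrite scaler_eq0 gt_eqF//= => /eqP; exact: A0.
Qed.

Lemma to_sphere_in A : (nA A)^-1 *: row_coords (val A) \in unit_sphere R (n * k).
Proof.
apply/mem_set; rewrite /unit_sphere /=.
under eq_bigr do rewrite mxE exprMn.
rewrite -mulr_sumr -[X in _ * X]sqr_sqrtr ?sumr_ge0// => [|i _]; last exact: sqr_ge0.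
by rewrite -exprMn mulVf ?expr1n// gt_eqF// nA_gt0.
Qed.

Definition to_sphere A : unit_sphere R (n * k) := 
  Sub ((nA A)^-1 *: row_coords (val A)) (to_sphere_in A).

Lemma enorm_sphere (x : unit_sphere R (n * k)) : enorm (val x) = 1.
Proof. by have /set_mem xS := valP x; rewrite /enorm xS sqrtr1. Qed.

Lemma of_sphere_in (x : unit_sphere R (n * k)) :
  zero_sum_mx (val x) \in W_rep_sum_minus0 R n.+1 k.
Proof.
apply/mem_set; split; first exact: zero_sum_mx_in.
move=> /= x0; have := enorm_sphere x.
rewrite -(zero_sum_mxK (val x)) x0 /row_coords /enorm big1 ?sqrtr0.
  by move/eqP; rewrite eq_sym oner_eq0.
by move=> i _; case/mxvec_indexP: i => i j; rewrite mxvecE !mxE expr0n.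
Qed.

Definition of_sphere (x : unit_sphere R (n * k)) : W_rep_sum_minus0 R n.+1 k :=
  Sub (zero_sum_mx (val x)) (of_sphere_in x).

(* Quadratic in t so as to be positive for every real t, not only on [0, 1]: the
   homotopy has to be defined on the whole of R. *)
Definition radial_weight (At : W_rep_sum_minus0 R n.+1 k * R) : R :=
  (1 - At.2) ^+ 2 * (nA At.1)^-1 + At.2 ^+ 2.

(** The first term is positive at t = 0, the second at every other t. *)
Lemma radial_weight_gt0 At : 0 < radial_weight At.
Proof.
case: At => A t; rewrite /radial_weight /=.
have [->|t0] := eqVneq t 0.
  by rewrite subr0 expr1n mul1r expr0n addr0 invr_gt0.
by rewrite ltr_wpDl ?exprn_even_gt0// mulr_ge0 ?sqr_ge0// invr_ge0 ltW.
Qed.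

(** Each matrix moves along its own open ray, from its normalization [of_sphere (to_sphere A)] at t
    = 0 to [A] at t = 1. *)
Definition radial_homotopy At : W_rep_sum_minus0 R n.+1 k :=
  Sub (radial_weight At *: val At.1) (scale_in _ At.1 (radial_weight_gt0 At)).

Lemma continuous_val (T : topologicalType) (A : set T) :
  continuous (val : A -> T).
Proof. exact: initial_continuous. Qed.

Lemma continuous_entry i j :
  continuous (fun A : W_rep_sum_minus0 R n.+1 k => val A i j).
Proof.
move=> A; apply: (@continuous_comp (W_rep_sum_minus0 R n.+1 k) 'M[R]_(n.+1, k) R val
    (fun M => M i j)).
  exact: continuous_val.
exact: coord_continuous.
Qed.

Lemma continuous_row_coords i :
  continuous (fun A : W_rep_sum_minus0 R n.+1 k => row_coords (val A) 0 i).
Proof.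
case/mxvec_indexP: i => i j; under eq_fun do rewrite mxvecE mxE.
exact: continuous_entry.
Qed.

Let nAV_continuous : continuous (fun A => (nA A)^-1).
Proof.
have nA_continuous : continuous nA.
  exact: (continuous_enorm (W_rep_sum_minus0 R n.+1 k) (fun A => row_coords (val A)) continuous_row_coords).
move=> A; apply: (@continuous_comp _ _ _ nA (fun a => a^-1)); last first.
  by apply: inv_continuous; rewrite gt_eqF ?nA_gt0.
exact: nA_continuous.
Qed.

Lemma continuous_to_sphere : continuous to_sphere.
Proof.
apply: continuous_comp_initial; apply: continuous_mx => i j.
rewrite ord1 (_ : (fun x => _) =
  fun A => (nA A)^-1 * row_coords (val A) 0 j); last first.
  by apply/funext => A; rewrite mxE.
exact: (continuous_mul _ _ _ _ nAV_continuous (continuous_row_coords j)).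
Qed.

Lemma continuous_of_sphere : continuous of_sphere.
Proof.
have vc i j : continuous (fun x : unit_sphere R (n * k) => vec_mx (val x) i j).
  rewrite (_ : (fun x => _) =
    fun x : unit_sphere R (n * k) => val x 0 (mxvec_index i j)); last first.
    by apply/funext => x; rewrite mxE.
  move=> x; apply: (@continuous_comp (unit_sphere R (n * k)) 'rV[R]_(n * k) R val
    (fun v => v 0 _)); first exact: continuous_val.
  exact: coord_continuous.
apply: continuous_comp_initial; apply: continuous_mx => i j.
case: (unliftP ord0 i) => [i' iE|iE].
  rewrite (_ : (fun x => _) =
    fun x : unit_sphere R (n * k) => vec_mx (val x) i' j).
    exact: vc.
  by apply/funext => x; rewrite mxE iE liftK.
rewrite (_ : (fun x => _) =
    fun x : unit_sphere R (n * k) => - \sum_i' vec_mx (val x) i' j).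
  have sc := continuous_sum _ _ _ (index_enum _) xpredT _ (fun i' => vc i' j).
  by move=> x; apply: continuousN; exact: sc.
by apply/funext => x; rewrite mxE iE unlift_none.
Qed.

Lemma continuous_radial_weight : continuous radial_weight.
Proof.
have wc (T : topologicalType) (f : T -> R) : continuous f ->
    continuous (fun At : T * R => (1 - At.2) ^+ 2 * f At.1 + At.2 ^+ 2).
  move=> fc At; apply: cvgD; last first.
    by under eq_fun do rewrite expr2; apply: cvgM; exact: cvg_snd.
  apply: cvgM; last by apply: continuous_comp; [exact: cvg_fst | exact: fc].
  under eq_fun do rewrite expr2.
  by apply: cvgM; (apply: cvgB; [exact: cvg_cst | exact: cvg_snd]).
exact: wc nAV_continuous.
Qed.

Lemma continuous_radial_homotopy : continuous radial_homotopy.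
Proof.
apply: continuous_comp_initial; apply: continuous_mx => i j.
rewrite (_ : (fun x => _) = fun At => radial_weight At * val At.1 i j); last first.
  by apply/funext => At; rewrite mxE.
apply: (continuous_mul _ _ _ _ continuous_radial_weight) => At.
apply: (@continuous_comp (W_rep_sum_minus0 R n.+1 k * R)%type
    (W_rep_sum_minus0 R n.+1 k) R fst (fun A => val A i j)).
  exact: cvg_fst.
exact: continuous_entry.
Qed.

Lemma W_rep_sum_minus0_sphere :
  homotopy_equivalent R (W_rep_sum_minus0 R n.+1 k) (unit_sphere R (n * k)).
Proof.
exists to_sphere, of_sphere; split.
- exact: continuous_to_sphere.
- exact: continuous_of_sphere.
- exists radial_homotopy; split.
  + exact/continuous_subspaceT/continuous_radial_homotopy.
  + move=> A; apply: val_inj => /=.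
    have /set_mem[WA _] := valP A.
    rewrite zero_sum_mxZ row_coordsK// /radial_weight /=.
    by rewrite subr0 expr1n mul1r expr0n addr0.
  + move=> A; apply: val_inj => /=.
    by rewrite /radial_weight /= subrr expr0n mul0r add0r expr1n scale1r.
(* Points of the sphere already have norm 1, so this composite is the identity and the constant
   homotopy suffices. *)
- have -> : to_sphere \o of_sphere = id.
    apply/funext => x; apply: val_inj => /=.
    by rewrite /nA /= zero_sum_mxK enorm_sphere invr1 scale1r.
  exists fst; split=> //.
  by apply: continuous_subspaceT => x; exact: cvg_fst.
Qed.

End SphereEquivalence.

Theorem proposition4p1 (R : realType) (r d N : nat)
    (hr : (2 <= r)%N) (hd : (1 <= d)%N) (hN : N = ((r - 1) * (d + 1))%N) :
  (exists F : realization R (join_power (chessboard r r) d.+1) ->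
              W_rep_sum_minus0 R r d.+1,
    continuous F /\
    morph_act (geom_action R (diag_action (row_action r r) d.+1))
              (W_action R r d.+1) F id) /\
  homotopy_equivalent R (W_rep_sum_minus0 R r d.+1) (unit_sphere R N).
Proof.
case: r hr hN => [//|[//|n]] _ ->; split.
  exists (join_map R n d); split; first exact: continuous_join_map.
  exact: join_map_equivariant.
(* Here r = n + 2, so dropping one row leaves n + 1 = r - 1 rows of d + 1 coordinates, N in all. *)
rewrite subn1 addn1; exact: W_rep_sum_minus0_sphere.
Qed.
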